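(* Let $\mathbb{I}\subseteq\mathbb{R}$ be a nontrivial real interval (nonempty and not a singleton), possibly unbounded, and let $F\colon\mathbb{I}^*\to\mathbb{R}$ be a function. Then $F$ is strongly B-preassociative and, for every $n\geqslant 1$, the $n$-ary part $F_n$ is continuous and strictly increasing in each argument, if and only if $F$ is a quasi-arithmetic pre-mean function.
   Context: $\mathbb{I}^*=\bigcup_{n\geqslant 0}\mathbb{I}^n$ is the set of all strings (tuples) over $\mathbb{I}$, with $\mathbb{I}^0=\{\varepsilon\}$, $\varepsilon$ being the empty string; $|\mathbf{x}|$ is the length of $\mathbf{x}$, and $F_n=F|_{\mathbb{I}^n}$. For $\mathbf{x}=x_1\cdots x_n\in\mathbb{I}^n$ and $K\subseteq\{1,\ldots,n\}$, $\mathbf{x}|_K$ is the string obtained from $\mathbf{x}$ by removing all letters $x_i$ with $i\notin K$. $F\colon\mathbb{I}^*\to\mathbb{R}$ is strongly B-preassociative if for every $\mathbf{x}\in\mathbb{I}^*$, every $\mathbf{x}'\in\mathbb{I}^{|\mathbf{x}|}$ and every $K\subseteq\{1,\ldots,|\mathbf{x}|\}$ with complement $K^c$: $F(\mathbf{x}|_K)=F(\mathbf{x}'|_K)$ and $\mathbf{x}'|_{K^c}=\mathbf{x}|_{K^c}$ imply $F(\mathbf{x})=F(\mathbf{x}')$. $F\colon\mathbb{I}^*\to\mathbb{R}$ is a quasi-arithmetic pre-mean function if there exist continuous and strictly increasing functions $f\colon\mathbb{I}\to\mathbb{R}$ and $f_n\colon f(\mathbb{I})\to\mathbb{R}$ ($n\geqslant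 1$) such that $$F_n(\mathbf{x})=f_n\Big(\frac1n\sum_{i=1}^n f(x_i)\Big),\qquad \mathbf{x}\in\mathbb{I}^n,\ n\geqslant 1$$ (no condition is imposed on $F(\varepsilon)$). *)

(* Defs.v *)
From HB Require Import structures.
From mathcomp Require Import all_boot all_order all_algebra.
From mathcomp Require Import all_classical all_reals all_analysis.

Set Implicit Arguments.
Unset Strict Implicit.
Unset Printing Implicit Defensive.

Import Order.TTheory GRing.Theory Num.Theory.
Import numFieldNormedType.Exports.

Local Open Scope classical_set_scope.
Local Open Scope ring_scope.

(* For [I : set R], the coercion [set_type] turns [I] into the type of its
   elements, with the topology induced by [R]; strings over [I] are therefore
   the elements of [seq I]. *)

Definition nontrivial_interval (R : realType) (I : set R) : Prop :=
  [/\ is_interval I, I !=set0 & forall a : R, I <> [set a]].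

(* Letter positions are numbered from 0, and the letters kept are listed by
   increasing position. *)
Definition restr (T : Type) (n : nat) (x : n.-tuple T) (K : {set 'I_n}) :
    seq T :=
  [seq tnth x i | i in K].

Definition strongly_B_preassociative (T S : Type) (F : seq T -> S) : Prop :=
  forall (n : nat) (x x' : n.-tuple T) (K : {set 'I_n}),
    F (restr x K) = F (restr x' K) -> restr x' (~: K) = restr x (~: K) ->
    F x = F x'.

(* Row vectors over [I] carry the product topology of [I ^ n], so this is joint
   continuity of the n-ary part of [F]. *)
Definition continuous_part (R : realType) (I : set R) (F : seq I -> R)
    (n : nat) : Prop :=
  continuous (fun v : 'rV[I]_n => F [seq v ord0 i | i <- enum 'I_n]).

Definition strictly_increasing_part (R : realType) (I : set R)
    (F : seq I -> R) (n : nat) : Prop :=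
  forall (x y : n.-tuple I) (k : 'I_n),
    (forall i : 'I_n, i != k -> tnth x i = tnth y i) ->
    set_val (tnth x k) < set_val (tnth y k) ->
    F x < F y.

(* A function on [f(I)] is encoded as a total function [R -> R] of which only
   the values on [range f] matter: the arithmetic mean of values of [f] is in
   [range f] because [I] is an interval and [f] is continuous. *)
Definition quasi_arithmetic_pre_mean (R : realType) (I : set R)
    (F : seq I -> R) : Prop :=
  exists (f : I -> R) (fn : nat -> R -> R),
    [/\ continuous f,
        forall x y : I, set_val x < set_val y -> f x < f y,
        forall n : nat, (1 <= n)%N ->
          {within range f, continuous (fn n)} /\
          {in range f &, forall u v : R, u < v -> fn n u < fn n v}
      & forall (n : nat) (x : n.-tuple I), (1 <= n)%N ->
          F x = fn n (n%:R^-1 * \sum_(i < n) f (tnth x i))].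

(* Main.v *)
(* Words over [I] of the same length are compared through [F].  Reducing the
   word [x y x y] to means in two ways shows that [F] is symmetric, so that
   comparison of words becomes a total order on the group of degree-zero
   integer combinations of points of [I].  Continuity and the connectedness of
   [I] make this ordered group Archimedean, and Hoelder's theorem embeds it in
   [R]: the image of [x - a] is the generator [f x].  Continuity of [f] holds
   because there are [c < d] with [f d - f c] arbitrarily small: for [x] near
   [s], continuity of [F] on pairs gives [F(x c) < F(s d)] and
   [F(s c) < F(x d)], hence [|f x - f s| < f d - f c]. *)
Require Import Defs.
From mathcomp Require Import all_boot all_order all_algebra.
From mathcomp Require Import all_classical all_reals all_analysis.
From mathcomp Require Import ring lra zify.

Set Implicit Arguments.
Unset Strict Implicit.
Unset Printing Implicit Defensive.

Import Order.TTheory GRing.Theory Num.Theory.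
Import numFieldNormedType.Exports.

Local Open Scope classical_set_scope.
Local Open Scope ring_scope.

(** * Hölder's embedding of Archimedean ordered abelian groups into the reals *)

Lemma eq0_bounded_multiples (R : realType) (x c : R) :
  (forall k : nat, `|x| * k%:R <= c) -> x = 0.
Proof.
move=> H; apply/eqP/negPn/negP => x0.
have x_gt0 : 0 < `|x| by rewrite normr_gt0.
have := H (Num.truncn (c / `|x|)).+1; apply/negP; rewrite -ltNge mulrC.
by rewrite -ltr_pdivrMr // truncnS_gt.
Qed.

Section Holder.
(** [P] is the nonnegative cone of a total preorder on the subgroup [D], and [~ P (- g)] says that
    [g] is strictly positive. The element [e] serves as unit of measurement. *)
Variables (R : realType) (V : zmodType) (D P : V -> Prop) (e : V).
Hypothesis DB : forall g h, D g -> D h -> D (g - h).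
Hypothesis De : D e.
Hypothesis PD : forall g h, P g -> P h -> P (g + h).
Hypothesis Ptotal : forall g, D g -> P g \/ P (- g).
Hypothesis Parch :
  forall g h, D g -> D h -> ~ P (- g) -> exists n, P (g *+ n - h).
Hypothesis e_gt0 : ~ P (- e).

Let D0 : D 0. Proof. by rewrite -(subrr e); exact: DB. Qed.

Let DN g : D g -> D (- g). Proof. by rewrite -sub0r; exact: DB. Qed.

Let DD g h : D g -> D h -> D (g + h).
Proof. by move=> Dg Dh; rewrite -(opprK h); apply/DB/DN. Qed.

Let DMn g n : D g -> D (g *+ n).
Proof. by move=> Dg; elim: n => [|n IHn]; rewrite ?mulr0n ?mulrS; auto. Qed.

Let P0 : P 0. Proof. by case: (Ptotal D0); rewrite ?oppr0. Qed.

Let PMn g n : P g -> P (g *+ n).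
Proof. by move=> Pg; elim: n => [|n IHn]; rewrite ?mulr0n ?mulrS; auto. Qed.

Let Pe : P e. Proof. by case: (Ptotal De). Qed.

Let P_mul_e k : P (e *~ k) -> 0 <= k.
Proof.
case: k => // n; rewrite NegzE mulrNz -pmulrn => Pn; case: e_gt0.
by rewrite (_ : - e = - (e *+ n.+1) + e *+ n);
  [auto | rewrite mulrS opprD addrNK].
Qed.

(** Adding [q'] times the lower bound to [q] times the upper bound cancels [g] and leaves a multiple
    of [e] in [P]; as [e] is strictly positive, its coefficient is nonnegative. *)
Let cross g (p p' : int) (q q' : nat) :
  P (g *+ q - e *~ p) -> P (e *~ p' - g *+ q') -> p * q'%:Z <= p' * q%:Z.
Proof.
move=> Pl Pu; rewrite -subr_ge0; apply: P_mul_e.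
have := PD (PMn q' Pl) (PMn q Pu); congr P.
rewrite !mulrnBl mulrzBr !mulrzA -!pmulrn (mulrnAC g q).
by rewrite addrC addrA subrK.
Qed.

(* [P g] says that [g] is nonnegative, and [psi g] is the supremum of the
   rationals [p / q] with [p e <= q g]. *)
Let A g : set R := [set r | exists (p : int) (q : nat),
  [/\ (0 < q)%N, r = p%:~R / q%:R & P (g *+ q - e *~ p)]].

Let psi g : R := sup (A g).

Let le_ratio (p p' : int) (q q' : nat) : (0 < q)%N -> (0 < q')%N ->
  p * q'%:Z <= p' * q%:Z -> p%:~R / q%:R <= p'%:~R / q'%:R :> R.
Proof.
move=> q0 q0' le; rewrite ler_pdivrMr ?ltr0n // mulrAC.
rewrite ler_pdivlMr ?ltr0n // !pmulrn -!intrM ler_int.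
by move: le; lia.
Qed.

Let A_ub g (p : int) (q : nat) : (0 < q)%N -> P (e *~ p - g *+ q) ->
  ubound (A g) (p%:~R / q%:R).
Proof.
move=> q0 Pu _ [p' [q' [q'0 -> Pl]]]; apply: le_ratio => //.
exact: cross Pl Pu.
Qed.

Let psi_ge g (p : int) (q : nat) : D g -> (0 < q)%N ->
  P (g *+ q - e *~ p) -> p%:~R / q%:R <= psi g.
Proof.
move=> Dg q0 Pl; apply: ub_le_sup; last by exists p, q.
(* The supremum is meaningful only if [A g] is bounded above: a multiple of [e] dominating [g]
   provides the bound. *)
have [n Pn] := Parch De Dg e_gt0; exists (n%:~R / 1%:R).
by apply: A_ub => //; rewrite -pmulrn.
Qed.

Let psi_le g (p : int) (q : nat) : D g -> (0 < q)%N ->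
  P (e *~ p - g *+ q) -> psi g <= p%:~R / q%:R.
Proof.
move=> Dg q0 Pu; apply: ge_sup; last exact: A_ub.
have [n Pn] := Parch De (DN Dg) e_gt0.
exists ((- n%:Z)%:~R / 1%:R), (- n%:Z), 1%N; split => //.
by rewrite mulrNz -pmulrn opprK addrC -[g]opprK.
Qed.

(** Integer part of [g] in the unit [e]. Adding [e *+ m] first makes [g] nonnegative, so that a
    least natural number can be taken. *)
Let floorP g : D g -> exists p, P (g - e *~ p) /\ P (e *~ (p + 1) - g).
Proof.
move=> Dg; have [m Pm] := Parch De (DN Dg) e_gt0; rewrite opprK in Pm.
have [n Pn] := Parch De Dg e_gt0.
have ex : exists k, `[< P (e *+ k - (g + e *+ m)) >].
  exists (n + m)%N; apply/asboolP; move: Pn; congr P.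
  by rewrite mulrnDr opprD addrACA subrr addr0.
case: (ex_minnP ex) => k /asboolP Pk min_k.
exists (k%:Z - 1 - m%:Z); split; last first.
  move: Pk; congr P; rewrite addrAC subrK mulrzBr -!pmulrn.
  by rewrite opprD addrA addrAC.
(* For [k = 0] there is no predecessor to contradict minimality; the lower bound then comes from the
   choice of [m]. *)
have [k0|k0] := posnP k.
  rewrite (_ : g - _ = e + (e *+ m + g)); first exact: PD Pe Pm.
  by rewrite k0 sub0r -opprD mulrNz opprK mulrzDr mulr1z -pmulrn addrC addrA.
have Dk : D (e *+ k.-1 - (g + e *+ m)) by auto.
case: (Ptotal Dk) => [/asboolP/min_k|]; first by lia.
congr P.
by rewrite -predn_int // mulrzBr opprB opprB -addrA.
Qed.

(** With [p] and [p'] the integer parts of [g *+ q] and [h *+ q], both [psi (g + h)] and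
    [psi g + psi h] lie between [(p + p') / q] and [(p + p' + 2) / q]. Their difference times [q] is
    thus at most 2 for every [q]. *)
Let psiD g h : D g -> D h -> psi (g + h) = psi g + psi h.
Proof.
move=> Dg Dh; apply/eqP; rewrite -subr_eq0; apply/eqP.
apply: (@eq0_bounded_multiples _ _ 2) => q.
have [->|q0] := posnP q; first by rewrite mulr0.
have [p [lp up]] := floorP (DMn q Dg).
have [p' [lp' up']] := floorP (DMn q Dh).
have l3 : P ((g + h) *+ q - e *~ (p + p')).
  have := PD lp lp'; congr P.
  by rewrite mulrnDl mulrzDr opprD addrACA.
have u3 : P (e *~ (p + p' + 2) - (g + h) *+ q).
  have := PD up up'; congr P.
  rewrite mulrnDl (_ : p + p' + 2 = p + 1 + (p' + 1)); last by ring.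
  by rewrite [in RHS]mulrzDr opprD addrACA.
have := psi_le (DD Dg Dh) q0 u3; have := psi_ge (DD Dg Dh) q0 l3.
have := psi_le Dg q0 up; have := psi_ge Dg q0 lp.
have := psi_le Dh q0 up'; have := psi_ge Dh q0 lp'.
have qR : 0 < q%:R :> R by rewrite ltr0n.
rewrite !(ler_pdivlMr, ler_pdivrMr) // !intrD => *.
rewrite -[X in _ * X](gtr0_norm qR) -normrM ler_norml; lra.
Qed.

Let psi_ge0 g : D g -> P g <-> 0 <= psi g.
Proof.
move=> Dg; split=> [Pg|].
  by have := @psi_ge g 0 1 Dg; rewrite mul0r mulr0z subr0 mulr1n; apply.
apply: contraPP => nPg; have [//|PNg] := Ptotal Dg.
(* If [g] is strictly negative, some multiple of [- g] exceeds [e], which forces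
   [psi g <= - 1 / n.+1]. *)
have := @Parch (- g) e (DN Dg) De; rewrite opprK => /(_ nPg)[[|n]].
  by rewrite mulr0n sub0r.
move=> Pn; apply/negP; rewrite -ltNge.
apply: (@le_lt_trans _ _ ((-1)%:~R / n.+1%:R)); last first.
  by rewrite pmulr_llt0 ?invr_gt0 ?ltr0n // ltrz0.
by apply: psi_le => //; rewrite mulrNz mulr1z addrC -mulNrn.
Qed.

Lemma holder_embedding : exists psi : V -> R,
  (forall g h, D g -> D h -> psi (g + h) = psi g + psi h) /\
  (forall g, D g -> P g <-> 0 <= psi g).
Proof. by exists psi. Qed.

End Holder.

(** * Topology of the interval and continuity of word functions *)

(** A nonempty clopen set of the type [I] is pushed to [R] by [set_val]: its open and closed
    descriptions become traces on [I] of an open and of a closed set of [R], so connectedness of the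
    interval applies. *)
Lemma connected_set_type (R : realType) (I : set R) :
  is_interval I -> connected [set: I].
Proof.
move=> /connected_intervalP cI B [x Bx] [U oU BU] [C clC BC].
rewrite setTI in BU; rewrite setTI in BC.
move: oU => [U' oU' UE]; have [W oW WE] := closed_openC clC.
have CW y : C y <-> ~ W (set_val y).
  have <- : (~` C) y <-> W (set_val y) by rewrite -WE.
  by rewrite /setC /= not_notP.
suff E : set_val @` C = I.
  apply/seteqP; split=> // y _.
  have : (set_val @` C) (set_val y) by rewrite E; exact: set_valP.
  by rewrite BC => -[z Cz /val_inj<-].
apply: cI.
  - by exists (set_val x), x; rewrite // -BC.
  - exists U' => //; apply/seteqP; split=> [_ [z Cz <-]|z [Iz U'z]].
      by split; [exact: set_valP | move: Cz; rewrite -BC BU -UE].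
    by exists (SigSub (mem_set Iz)) => //; rewrite -BC BU -UE.
  - exists (~` W); first exact: open_closedC.
    apply/seteqP; split=> [_ [z Cz <-]|z [Iz Wz]].
      by split; [exact: set_valP | apply/CW].
    by exists (SigSub (mem_set Iz)) => //; apply/CW.
Qed.

Lemma range_is_interval (R : realType) (I : set R) (g : I -> R) :
  is_interval I -> continuous g -> is_interval (range g).
Proof.
move=> intI cg; apply/connected_intervalP/connected_continuous_connected.
  exact: connected_set_type.
exact: continuous_subspaceT.
Qed.

(** Yields one-variable continuity from joint continuity. Neighbourhoods of a row vector are given
    entrywise, and the finitely many entry conditions hold simultaneously near [t]. *)
Lemma continuous_partP (R : realType) (I : set R) (F : seq I -> R) (n : nat)
    (h : 'I_n -> I -> I) :
  continuous_part F n -> (forall i, continuous (h i)) ->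
  continuous (fun t => F [seq h i t | i <- enum 'I_n]).
Proof.
move=> cF ch t; pose r t : 'rV[I]_n := \row_i h i t.
have -> : (fun t => F [seq h i t | i <- enum 'I_n]) =
    (fun v : 'rV[I]_n => F [seq v ord0 i | i <- enum 'I_n]) \o r.
  by apply/funext => s /=; congr F; apply: eq_map => i; rewrite mxE.
apply: continuous_comp; last exact: cF.
move=> U [P nP PU]; rewrite nbhs_filterE /=.
have : \forall s \near t, forall i, P ord0 i (h i s).
  apply: (@filter_forall I 'I_n (fun i s => P ord0 i (h i s)) (nbhs t)) => i.
  have Pi : nbhs (h i t) (P ord0 i) by have := nP ord0 i; rewrite mxE.
  exact: (ch i t _ Pi).
apply: filterS => s Ps; apply: PU => i j; rewrite mxE ord1; exact: Ps.
Qed.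

(** * Replacement of subwords, means and symmetry of [F] *)

(** Unlike index sets, bit masks compute on concatenated words. *)
Lemma restr_mask (T : Type) (n : nat) (x : n.-tuple T) (K : {set 'I_n}) :
  restr x K = mask [seq i \in K | i <- enum 'I_n] x.
Proof.
rewrite /restr /image_mem -[X in mask _ X]map_tnth_enum -map_mask -filter_mask.
by rewrite {1}enumT.
Qed.

Section Words.
Variables (R : realType) (I : set R) (F : seq I -> R).
Hypothesis Fpre : strongly_B_preassociative F.

Lemma spa_mask (m : bitseq) (s s' : seq I) :
  size m = size s -> size s' = size s ->
  F (mask m s) = F (mask m s') ->
  mask (map negb m) s' = mask (map negb m) s -> F s = F s'.
Proof.
move=> ms ss' FK Kc; pose K : {set 'I_(size s)} :=
  [set i | nth false m (val i)]%SET.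
have mK : [seq i \in K | i <- enum 'I_(size s)] = m.
  rewrite (eq_map (g := nth false m \o val)); last by move=> i; rewrite inE.
  by rewrite map_comp val_enum_ord -ms; exact: mkseq_nth.
have mKc : [seq i \in ~: K | i <- enum 'I_(size s)] = map negb m.
  by rewrite -mK -map_comp; apply: eq_map => i /=; rewrite inE.
have := @Fpre _ (in_tuple s) (Tuple (introT eqP ss')) K.
by rewrite !restr_mask mK mKc; apply.
Qed.

Lemma spa_cat (s u v t : seq I) : size u = size v -> F u = F v ->
  F (s ++ u ++ t) = F (s ++ v ++ t).
Proof.
move=> uv Fuv.
pose m := nseq (size s) false ++ nseq (size u) true ++ nseq (size t) false.
apply: (@spa_mask m); rewrite /m ?size_cat ?size_nseq ?uv //.
  rewrite !mask_cat ?size_nseq // !mask_false !mask_true ?uv //=.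
  by rewrite !cats0.
rewrite !map_cat !map_nseq /= !mask_cat ?size_nseq //.
by rewrite !mask_false !mask_true.
Qed.

Hypothesis Fmono : forall n, (1 <= n)%N -> strictly_increasing_part F n.

Lemma F_lt (s t : seq I) (x y : I) : set_val x < set_val y ->
  F (s ++ x :: t) < F (s ++ y :: t).
Proof.
move=> xy; set n := size (s ++ x :: t).
have n0 : (0 < n)%N by rewrite /n size_cat addnS.
have sy : size (s ++ y :: t) == n by rewrite /n !size_cat.
have sn : (size s < n)%N by rewrite /n size_cat addnS ltnS leq_addr.
have := @Fmono n n0 (in_tuple (s ++ x :: t)) (Tuple sy) (Ordinal sn).
apply.
  move=> i /eqP ine; rewrite !(tnth_nth x) /= !nth_cat.
  case: ltnP => // si; case ei: (i - size s)%N => //.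
  case: ine; apply: val_inj => /=; apply/eqP.
  by rewrite eqn_leq si andbT -subn_eq0 ei.
by rewrite !(tnth_nth x) /= !nth_cat ltnn subnn.
Qed.

Lemma F_le (s t : seq I) (x y : I) : set_val x <= set_val y ->
  F (s ++ x :: t) <= F (s ++ y :: t).
Proof. by rewrite le_eqVlt => /predU1P[/val_inj->//|/F_lt/ltW]. Qed.

Lemma F_nseq_le (w s t : seq I) (x : I) :
  all (fun y => set_val x <= set_val y) s ->
  F (w ++ nseq (size s) x ++ t) <= F (w ++ s ++ t).
Proof.
elim: s w => [|y s IHs] w //= /andP[xy xs].
by apply: le_trans (F_le _ _ xy) _; rewrite -!cat_rcons; exact: IHs.
Qed.

Lemma F_le_nseq (w s t : seq I) (x : I) :
  all (fun y => set_val y <= set_val x) s ->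
  F (w ++ s ++ t) <= F (w ++ nseq (size s) x ++ t).
Proof.
elim: s w => [|y s IHs] w //= /andP[xy xs].
by apply: le_trans (F_le _ _ xy) _; rewrite -!cat_rcons; exact: IHs.
Qed.

Lemma F_nseq_lt (w t : seq I) (n : nat) (x y : I) : set_val x < set_val y ->
  F (w ++ nseq n.+1 x ++ t) < F (w ++ nseq n.+1 y ++ t).
Proof.
move=> xy; apply: (lt_le_trans (F_lt _ _ xy)) => /=.
have := @F_nseq_le (rcons w y) (nseq n y) t x; rewrite size_nseq !cat_rcons.
by apply; rewrite all_nseq (ltW xy) orbT.
Qed.

Lemma F_nseq_ltE (t : seq I) (n : nat) (x y : I) :
  (F (nseq n.+1 x ++ t) < F (nseq n.+1 y ++ t)) = (set_val x < set_val y).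
Proof.
case: (ltgtP (set_val x) (set_val y)) => [xy|yx|/val_inj->]; last exact: ltxx.
  exact: (@F_nseq_lt [::]).
by apply/negbTE; rewrite -leNgt; apply/ltW/(@F_nseq_lt [::]).
Qed.

Hypothesis intI : is_interval I.
Hypothesis Fcont : forall n, (1 <= n)%N -> continuous_part F n.

Lemma diag_continuous (n : nat) : (0 < n)%N ->
  continuous (fun t : I => F (nseq n t)).
Proof.
move=> n0; have := @continuous_partP _ _ F n (fun _ => id) (Fcont n0).
have -> : (fun t : I => F [seq t | _ <- enum 'I_n]) = fun t => F (nseq n t).
  apply/funext => t; rewrite -[in RHS](size_enum_ord n).
  by congr F; elim: (enum 'I_n) => //= i s ->.
by apply=> i t; exact: cvg_id.
Qed.

Lemma pair_continuous (c : I) : continuous (fun t : I => F [:: t; c]).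
Proof.
pose h (i : 'I_2) (t : I) := if i == ord0 then t else c.
have -> : (fun t : I => F [:: t; c]) = fun t => F [seq h i t | i <- enum 'I_2].
  by apply/funext => t; rewrite !enum_ordSl enum_ord0 /h /=.
apply: continuous_partP => [|i]; first exact: Fcont.
by rewrite /h; case: eqP => _; 
  [move=> t; exact: cvg_id | exact: cst_continuous].
Qed.

Lemma seq_bounds (x : I) (s : seq I) : exists lo hi : I,
  all (fun y => set_val lo <= set_val y) (x :: s) /\
  all (fun y => set_val y <= set_val hi) (x :: s).
Proof.
elim: s x => [|y s IHs] x; first by exists x, x; rewrite /= lexx.
have [lo [hi [lo_s hi_s]]] := IHs y.
exists (if set_val x <= set_val lo then x else lo).
exists (if set_val hi <= set_val x then x else hi).
split; case: leP => c; rewrite [all _ (x :: _)]/=.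
- rewrite lexx; apply: sub_all lo_s => z; exact: le_trans.
- by rewrite (ltW c).
- rewrite lexx; apply: sub_all hi_s => z /le_trans; exact.
- by rewrite (ltW c).
Qed.

(** Intermediate values along the diagonal: by monotonicity [F s] lies between the values of [F] at
    the constant words on a lower and an upper bound of the letters. *)
Lemma mean_exists (s : seq I) : (0 < size s)%N ->
  exists m : I, F s = F (nseq (size s) m).
Proof.
case: s => // x s _; have [lo [hi [los his]]] := seq_bounds x s.
have := range_is_interval intI (@diag_continuous (size (x :: s)) isT).
move=> /(_ (F (nseq (size (x :: s)) lo)) (F (nseq (size (x :: s)) hi)) _ _
  (F (x :: s))).
case; first by exists lo.
- by exists hi.
- have := @F_nseq_le [::] (x :: s) [::] lo los.
  have := @F_le_nseq [::] (x :: s) [::] hi his.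
  by rewrite !cats0 => -> ->.
- by move=> m _ Fm; exists m.
Qed.

(* With [F [:: x; y] = F [:: m; m]] and [F [:: y; x] = F [:: m'; m']], the word
   [x y x y] can be reduced pairing its letters as 12|34 or as 14|23. *)
Lemma F_swap2 (x y : I) : F [:: x; y] = F [:: y; x].
Proof.
have [m Em] := @mean_exists [:: x; y] isT.
have [m' Em'] := @mean_exists [:: y; x] isT.
have E1 : F [:: x; y; x; y] = F [:: m; m; m; m].
  rewrite (@spa_cat [::] [:: x; y] [:: m; m] [:: x; y]) //.
  by rewrite (@spa_cat [:: m; m] [:: x; y] [:: m; m] [::]).
have E2 : F [:: x; y; x; y] = F [:: m; m'; m'; m].
  rewrite (@spa_cat [:: x] [:: y; x] [:: m'; m'] [:: y]) //.
  exact: (@spa_mask [:: true; false; false; true]).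
have [mm'|mm'|/val_inj mm'] := ltgtP (set_val m) (set_val m'); last first.
- by rewrite Em Em' mm'.
- by have := @F_nseq_lt [:: m] [:: m] 1 _ _ mm'; rewrite /= -E1 E2 ltxx.
- by have := @F_nseq_lt [:: m] [:: m] 1 _ _ mm'; rewrite /= -E1 E2 ltxx.
Qed.

Lemma F_perm (s t : seq I) : perm_eq s t -> F s = F t.
Proof.
have Fcons x u v : size u = size v -> F u = F v -> F (x :: u) = F (x :: v).
  by move=> suv /(@spa_cat [:: x] u v [::] suv); rewrite !cats0.
(* A letter moves across a block by successive adjacent swaps. *)
have Fmid x u v : F (x :: u ++ v) = F (u ++ x :: v).
  elim: u v => //= y u IHu v.
  rewrite (@spa_cat [::] [:: x; y] [:: y; x] (u ++ v)) //; last exact: F_swap2.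
  by apply: Fcons; rewrite //= !size_cat addnS.
elim: s t => [|x s IHs] t; first by move/perm_size/esym/size0nil->.
move=> xst; have xt : x \in t by rewrite -(perm_mem xst) mem_head.
case/splitPr: xt xst => t1 t2 xst; rewrite -Fmid.
have st : perm_eq s (t1 ++ t2).
  by rewrite -(perm_cons x) (permPl xst) perm_catC /= perm_cons perm_catC.
by apply: Fcons; [exact: perm_size | exact: IHs].
Qed.

(** Once [u] and [v] are replaced by constant words, both sides reduce to the comparison of their
    letters [m] and [m'], whatever [w] is. *)
Lemma F_cat_lt (u v w : seq I) : size u = size v ->
  (F (u ++ w) < F (v ++ w)) = (F u < F v).
Proof.
case: u v => [|x u] [|y v] // suv; first by rewrite !ltxx.
have [m Em] := @mean_exists (x :: u) isT.
have [m' Em'] := @mean_exists (y :: v) isT; rewrite -suv in Em'.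
rewrite (@spa_cat [::] (x :: u) (nseq (size (x :: u)) m) w) ?size_nseq //.
rewrite (@spa_cat [::] (y :: v) (nseq (size (x :: u)) m') w) ?size_nseq //.
have := F_nseq_ltE [::] (size u) m m'; rewrite !cats0 Em Em' => ->.
exact: (F_nseq_ltE w (size u) m m').
Qed.

Lemma F_cat_le (u v w : seq I) : size u = size v ->
  (F (u ++ w) <= F (v ++ w)) = (F u <= F v).
Proof. by move=> suv; rewrite !leNgt F_cat_lt. Qed.

Lemma F_cat_lel (u v w : seq I) : size u = size v ->
  (F (w ++ u) <= F (w ++ v)) = (F u <= F v).
Proof.
move=> suv; rewrite -(F_cat_le w suv); congr (_ <= _); apply: F_perm;
  exact: permEl (perm_catC _ _).
Qed.

Lemma near_pair_lt (c d s : I) : set_val c < set_val d ->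
  \forall x \near s, F [:: x; c] < F [:: s; d] /\ F [:: s; c] < F [:: x; d].
Proof.
move=> cd; have lt_s : F [:: s; c] < F [:: s; d] by exact: (@F_lt [:: s]).
apply: filterI.
  exact: (cvgr_lt (F [:: s; c]) (@pair_continuous c s) _ lt_s).
exact: (cvgr_gt (F [:: s; d]) (@pair_continuous d s) _ lt_s).
Qed.

(** * The Archimedean ordered group of degree-zero combinations of letters *)

Let V : zmodType := I -> int.

Let cnt (u : seq I) : V := fun y => (count_mem y u)%:Z.

Let cnt_cat u v : cnt (u ++ v) = cnt u + cnt v.
Proof. by apply/funext => y; rewrite /cnt count_cat PoszD. Qed.


Let cnt_perm u v : cnt u = cnt v -> perm_eq u v.
Proof.
by move=> uv; apply/allP => y _ /=; have [/eqP] := congr1 (@^~ y) uv.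
Qed.

Let D (g : V) := exists u v, size u = size v /\ g = cnt v - cnt u.

Let P (g : V) := exists u v,
  [/\ size u = size v, g = cnt v - cnt u & F u <= F v].

Let D_cnt u v : size u = size v -> D (cnt v - cnt u).
Proof. by exists u, v. Qed.

(** The sign of an element does not depend on the words representing it: if [v - u = v' - u'], then
    [v ++ u'] and [v' ++ u] are permutations of each other, and the common factors [u'] and [u]
    cancel. *)
Let P_cnt u v : size u = size v -> P (cnt v - cnt u) <-> F u <= F v.
Proof.
move=> suv; split=> [[u' [v' [suv' E le']]]|]; last by exists u, v.
have vu : F (v ++ u') = F (v' ++ u).
  apply/F_perm/cnt_perm; rewrite !cnt_cat.
  by rewrite -(subrK (cnt u) (cnt v)) E addrAC subrK.
rewrite -(F_cat_le u' suv) vu (F_perm (permEl (perm_catC u u'))).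
by rewrite F_cat_le.
Qed.

Let DB g h : D g -> D h -> D (g - h).
Proof.
move=> [u [v [suv ->]]] [u' [v' [suv' ->]]].
exists (u ++ v'), (v ++ u'); split; first by rewrite !size_cat suv suv'.
by rewrite !cnt_cat opprB opprD [in RHS]addrACA.
Qed.

Let PD g h : P g -> P h -> P (g + h).
Proof.
move=> [u [v [suv -> le]]] [u' [v' [suv' -> le']]].
exists (u ++ u'), (v ++ v'); split; first by rewrite !size_cat suv suv'.
  by rewrite !cnt_cat opprD addrACA.
by apply: (@le_trans _ _ (F (v ++ u'))); rewrite ?F_cat_le ?F_cat_lel.
Qed.

Let Ptotal g : D g -> P g \/ P (- g).
Proof.
move=> [u [v [suv ->]]]; rewrite opprB !P_cnt //.
by case/orP: (le_total (F u) (F v)) => ?; [left|right].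
Qed.

Let P0 : P 0. Proof. by exists [::], [::]; rewrite subrr. Qed.

Let PMn g n : P g -> P (g *+ n).
Proof.
move=> Pg; elim: n => [//|n IHn]; rewrite mulrS; exact: PD.
Qed.

Section Unit.
Variables m m' : I.
Hypothesis mm' : set_val m < set_val m'.
Let e := cnt [:: m'] - cnt [:: m].
Let B h := exists N, P (e *+ N - h).

Let BD g h : B g -> B h -> B (g + h).
Proof.
move=> [N PN] [N' PN']; exists (N + N')%N.
by have := PD PN PN'; rewrite mulrnDr opprD addrACA.
Qed.

(** For [y] near [x] a single copy of [e] dominates both [y - x] and [x - y]: these are the two pair
    inequalities of [near_pair_lt]. *)
Let B_near x : \forall y \near x,
  B (cnt [:: y] - cnt [:: x]) /\ B (cnt [:: x] - cnt [:: y]).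
Proof.
have E a b : e *+ 1 - (cnt [:: a] - cnt [:: b]) =
    cnt [:: b; m'] - cnt [:: a; m].
  rewrite -[[:: b; m']]/([:: b] ++ [:: m']) -[[:: a; m]]/([:: a] ++ [:: m]).
  by rewrite !cnt_cat mulr1n opprB opprD [in RHS]addrACA addrC.
apply: filterS (near_pair_lt x mm') => y [/ltW lt1 /ltW lt2].
by split; exists 1%N; rewrite E; apply/P_cnt.
Qed.

(* The points with this property form a clopen subset of [I]. *)
Let B_base x : B (cnt [:: x] - cnt [:: m]) /\ B (cnt [:: m] - cnt [:: x]).
Proof.
pose S := [set x | B (cnt [:: x] - cnt [:: m]) /\ B (cnt [:: m] - cnt [:: x])].
have step y z : B (cnt [:: y] - cnt [:: z]) -> B (cnt [:: z] - cnt [:: y]) ->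
    S z -> S y.
  move=> yz zy [zm mz]; split.
    by have := BD yz zm; rewrite addrA subrK.
  by have := BD mz zy; rewrite addrA subrK.
have S_near y : \forall z \near y, S y <-> S z.
  by apply: filterS (B_near y) => z [zy yz]; split; exact: step.
suff: S x by [].
suff -> : S = setT by [].
apply: (connected_set_type intI).
- by exists m; split; exists 0%N; rewrite mulr0n ?subrr ?subr0.
- exists S; rewrite ?setTI // openE => y Sy.
  by apply: filterS (S_near y) => z [+ _]; exact.
- exists S; rewrite ?setTI // -(setCK S); apply: open_closedC; rewrite openE.
  move=> y nSy; apply: filterS (S_near y) => z [_ zy] /zy; exact: nSy.
Qed.

(** Pair the letters of the two words and write each difference as [y - x = (y - m) + (m - x)]. *)
Let B_D h : D h -> B h.
Proof.
move=> [u [v [+ ->]]]; elim: u v => [|x u IHu] [|y v] //= => [_|[/IHu Buv]].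
  by exists 0%N; rewrite mulr0n ?subrr ?subr0.
have [By _] := B_base y; have [_ Bx] := B_base x.
have := BD (BD By Bx) Buv; rewrite (addrA _ (cnt [:: m])) subrK.
by rewrite -(cat1s x u) -(cat1s y v) !cnt_cat opprD addrACA.
Qed.

Lemma unit_archimedean h : D h -> exists N, P (e *+ N - h).
Proof. exact: B_D. Qed.

End Unit.

(** A strictly positive [g = v - u] dominates the unit [m' - m] built from the means of [v] and [u],
    and multiples of that unit dominate [h]. *)
Let Parch g h : D g -> D h -> ~ P (- g) -> exists n, P (g *+ n - h).
Proof.
move=> [u [v [suv ->]]] Dh; case: u v suv => [|x u] [|y v] // suv.
rewrite opprB P_cnt // => /negP; rewrite -ltNge => lt_uv.
have [m Em] := @mean_exists (x :: u) isT.
have [m' Em'] := @mean_exists (y :: v) isT; rewrite -suv in Em'.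
have mm' : set_val m < set_val m'.
  by have := F_nseq_ltE [::] (size u) m m'; rewrite !cats0 -Em -Em' lt_uv.
have [N PN] := unit_archimedean mm' Dh; exists N.
set d := cnt (y :: v) - cnt (x :: u); set e := cnt [:: m'] - cnt [:: m] in PN.
suff Pde : P (d - e).
  by have := PD (PMn N Pde) PN; rewrite mulrnBl addrA subrK.
have -> : d - e = cnt ((y :: v) ++ [:: m]) - cnt ((x :: u) ++ [:: m']).
  by rewrite !cnt_cat opprB opprD addrACA.
apply/P_cnt; first by rewrite !size_cat suv.
rewrite (@spa_cat [::] (x :: u) (nseq (size u).+1 m)) ?size_nseq //.
rewrite (@spa_cat [::] (y :: v) (nseq (size u).+1 m')) ?size_nseq //.
(* Both words are rearranged to end in [m m'], leaving [size u] copies of [m] against as many copies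
   of [m']. *)
have -> : F ([::] ++ nseq (size u).+1 m ++ [:: m']) =
    F (nseq (size u) m ++ [:: m; m']).
  by apply: F_perm; rewrite (perm_catCA [:: m] _ [:: m']).
have -> : F ([::] ++ nseq (size u).+1 m' ++ [:: m]) =
    F (nseq (size u) m' ++ [:: m; m']).
  apply: F_perm; rewrite /= (perm_catCA [:: m'] _ [:: m]) /=.
  by rewrite perm_cat2l (perm_catC [:: m'] [:: m]).
have := @F_nseq_le [::] (nseq (size u) m') [:: m; m'] m.
by rewrite size_nseq; apply; rewrite all_nseq (ltW mm') orbT.
Qed.

(** With [f x] the image of [x - a], the base point [a] cancels in [v - u] because the two words
    have equal length. *)
Lemma additive_representation (a b : I) : set_val a < set_val b ->
  exists f : I -> R, forall u v, size u = size v ->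
    (F u <= F v) = (\sum_(x <- u) f x <= \sum_(x <- v) f x).
Proof.
move=> ab; have [||psi [psiD psiP]] := @holder_embedding R V D P
  (cnt [:: b] - cnt [:: a]) DB _ PD Ptotal Parch.
- exact: D_cnt.
- by rewrite opprB P_cnt // => /le_gtF; rewrite (@F_lt [::]).
have D0 : D 0 by exists [::], [::]; rewrite subrr.
have psi0 : psi 0 = 0.
  apply/eqP; have /eqP := psiD 0 0 D0 D0.
  by rewrite addr0 -subr_eq subrr eq_sym.
pose f x := psi (cnt [:: x] - cnt [:: a]); exists f => u v suv.
have psiN x : psi (cnt [:: a] - cnt [:: x]) = - f x.
  apply/eqP; rewrite -addr_eq0 -psiD; [|exact: D_cnt..].
  by rewrite addrA subrK subrr psi0.
have psi_sum : psi (cnt v - cnt u) = \sum_(x <- v) f x - \sum_(x <- u) f x.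
  elim: u v suv => [|x u IHu] [|y v] //= => [_|[suv]].
    by rewrite !big_nil !subrr.
  have -> : cnt (y :: v) - cnt (x :: u) = (cnt [:: y] - cnt [:: a]) +
      ((cnt [:: a] - cnt [:: x]) + (cnt v - cnt u)).
    rewrite -(cat1s x u) -(cat1s y v) !cnt_cat opprD addrACA.
    by rewrite !addrA subrK.
  rewrite psiD; [|exact: D_cnt|]; last first.
    exists (x :: u), (a :: v); split; first by rewrite /= suv.
    by rewrite -(cat1s x u) -(cat1s a v) !cnt_cat opprD [in RHS]addrACA.
  rewrite (psiD (cnt [:: a] - cnt [:: x])) ?psiN ?IHu //; try exact: D_cnt.
  by rewrite !big_cons opprD [RHS]addrACA -addrA.
apply/idP/idP => [/P_cnt|le].
  by move=> /(_ suv)/psiP; rewrite psi_sum subr_ge0; apply; exact: D_cnt.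
by apply/P_cnt => //; apply/psiP; rewrite ?psi_sum ?subr_ge0; auto.
Qed.

End Words.

(** * From the additive representation to a pre-mean function *)

(** An increasing function whose image is an interval cannot jump: a value slightly below [h x] is
    attained at some [v < x], which bounds [h] from below to the right of [v]; symmetrically
    above. *)
Lemma increasing_continuous (R : realType) (J : set R) (h : R -> R) :
  {in J &, forall u v, u < v -> h u < h v} -> is_interval (h @` J) ->
  {within J, continuous h}.
Proof.
move=> hlt intJ; apply/subspace_continuousP => x Jx.
have hle u v : J u -> J v -> u <= v -> h u <= h v.
  move=> Ju Jv; rewrite le_eqVlt => /predU1P[->//|uv].
  by apply/ltW/hlt; rewrite ?inE.
apply/cvgrPdist_lt => eps eps0; rewrite near_withinE.
have lower : \forall y \near x, J y -> h x - eps < h y.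
  have [[w [Jw wx]]|noJ] := pselect (exists w, J w /\ w < x); last first.
    apply: (@nearW _ (nbhs x)) => y Jy; apply: (@lt_le_trans _ _ (h x)).
      by rewrite ltrBlDr ltrDl.
    by apply: hle => //; rewrite leNgt; apply/negP => yx; apply: noJ; exists y.
  have hwx : h w < h x by apply: hlt; rewrite ?inE.
  pose t := Num.max (h w) (h x - eps / 2).
  have tx : t < h x by rewrite gt_max hwx ltrBlDr ltrDl divr_gt0.
  have [v Jv vt] : (h @` J) t.
    apply: (intJ (h w) (h x)); first by exists w.
      by exists x.
    by rewrite (ltW tx) le_max lexx.
  have vx : v < x.
    by rewrite ltNge; apply/negP => /(hle _ _ Jx Jv); rewrite vt leNgt tx.
  apply: filterS (lt_nbhsr vx) => y vy Jy.
  apply: (@lt_trans _ _ (h v)); last by apply: hlt; rewrite ?inE.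
  by rewrite vt lt_max; apply/orP; right; rewrite ltrD2l ltrN2; lra.
have upper : \forall y \near x, J y -> h y < h x + eps.
  have [[w [Jw wx]]|noJ] := pselect (exists w, J w /\ x < w); last first.
    apply: (@nearW _ (nbhs x)) => y Jy.
    apply: (@le_lt_trans _ _ (h x)); last by rewrite ltrDl.
    by apply: hle => //; rewrite leNgt; apply/negP => yx; apply: noJ; exists y.
  have hwx : h x < h w by apply: hlt; rewrite ?inE.
  pose t := Num.min (h w) (h x + eps / 2).
  have tx : h x < t by rewrite lt_min hwx ltrDl divr_gt0.
  have [v Jv vt] : (h @` J) t.
    apply: (intJ (h x) (h w)); first by exists x.
      by exists w.
    by rewrite (ltW tx) ge_min lexx.
  have vx : x < v.
    by rewrite ltNge; apply/negP => /(hle _ _ Jv Jx); rewrite vt leNgt tx.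
  apply: filterS (lt_nbhsl vx) => y vy Jy.
  apply: (@lt_trans _ _ (h v)); first by apply: hlt; rewrite ?inE.
  by rewrite vt gt_min; apply/orP; right; rewrite ltrD2l; lra.
apply: filterS2 lower upper => y lo up Jy.
by rewrite ltr_distlC lo ?up.
Qed.

Lemma sum_nseq (R : realType) (T : Type) (f : T -> R) (n : nat) (x : T) :
  \sum_(y <- nseq n x) f y = n%:R * f x.
Proof. by rewrite big_nseq iter_addr_0 mulr_natl. Qed.

Lemma pre_mean_of_spa (R : realType) (I : set R) (F : seq I -> R) :
  nontrivial_interval I -> strongly_B_preassociative F ->
  (forall n, (1 <= n)%N -> continuous_part F n /\
    strictly_increasing_part F n) ->
  quasi_arithmetic_pre_mean F.
Proof.
move=> [intI [x0 Ix0] nsing] Fpre H.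
have Fcont n n1 := (H n n1).1; have Fmono n n1 := (H n n1).2.
have [a [b ab]] : exists a b : I, set_val a < set_val b.
  have [y Iy yx] : exists2 y, I y & y != x0.
    apply: contrapT => nex; apply: (nsing x0).
    apply/seteqP; split=> [y Iy|_ ->//].
    by apply: contrapT => /eqP yx; apply: nex; exists y.
  pose p := SigSub (mem_set Ix0) : I; pose q := SigSub (mem_set Iy) : I.
  by case: (ltgtP y x0) yx => // [lt _|lt _]; [exists q, p | exists p, q].
have [f fP] := additive_representation Fpre Fmono intI Fcont ab.
have fltP u v : size u = size v ->
    (F u < F v) = (\sum_(x <- u) f x < \sum_(x <- v) f x).
  by move=> suv; rewrite !ltNge fP.
have flt x y : set_val x < set_val y -> f x < f y.
  by move=> /(@F_lt _ _ _ Fmono [::] [::]); rewrite fltP // !big_seq1.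
have f_eq u v : size u = size v -> F u = F v ->
    \sum_(x <- u) f x = \sum_(x <- v) f x.
  by move=> suv Fuv; apply/eqP; rewrite eq_le -!fP // Fuv lexx.
have f_inj : injective f.
  move=> x y fxy.
  by case: (ltgtP (set_val x) (set_val y)) => [/flt|/flt|/val_inj//];
    rewrite fxy ltxx.
have f_cont : continuous f.
  move=> s; apply/(@cvgrPdist_lt _ _ _ (nbhs s) (nbhs_filter s)) => eps eps0.
  have fab : 0 < f b - f a by rewrite subr_gt0 flt.
  (* This [n] makes [(f b - f a) / n.+1], which will be [f m - f a], smaller than [eps]. *)
  pose n := Num.truncn ((f b - f a) / eps).
  (* [m] is the mean of [b] and [n] copies of [a]. *)
  have [m /f_eq] :=
    mean_exists Fmono intI Fcont (isT : (0 < size (b :: nseq n a))%N).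
  rewrite size_nseq => /(_ erefl).
  rewrite big_cons !sum_nseq /= size_nseq => fm.
  have {}fm : n.+1%:R * (f m - f a) = f b - f a.
    by rewrite mulrBr -fm -[n.+1]addn1 natrD; ring.
  have n0 : 0 < n.+1%:R :> R by rewrite ltr0n.
  have fma : 0 < f m - f a by rewrite -(pmulr_rgt0 _ n0) fm.
  have fme : f m - f a < eps.
    rewrite -(ltr_pM2l n0) fm -ltr_pdivrMr //; exact: truncnS_gt.
  have am : set_val a < set_val m.
    case: (ltgtP (set_val a) (set_val m)) => // [/flt|/val_inj am]; last first.
      by move: fma; rewrite am subrr ltxx.
    by move: fma; rewrite subr_gt0 => /lt_trans/[apply]; rewrite ltxx.
  have := near_pair_lt Fmono Fcont s am; apply: (@filterS _ (nbhs s)) => x.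
  (* In terms of [f] the pair inequalities read [f x + f a < f s + f m] and
     [f s + f a < f x + f m]. *)
  rewrite !fltP // !big_cons !big_nil => -[lt1 lt2].
  by rewrite ltr_distlC; apply/andP; split; lra.
(* Left inverse of [f], with default value [a] outside [range f]. *)
pose g u := xget a [set x | f x = u].
have gK x : g (f x) = x.
  apply: f_inj.
  exact: (@xgetPex _ a [set y | f y = f x] (ex_intro _ x erefl)).
(* The outer function is the diagonal of [F] read in the coordinate [f]: a word has the same
   [F]-value as the constant word on its mean [m], and [f m] is the arithmetic mean of the values of
   [f]. *)
exists f, (fun n u => F (nseq n (g u))); split=> // [n n1|n x n1]; last first.
  have := mean_exists Fmono intI Fcont (_ : 0 < size x)%N.
  rewrite size_tuple => /(_ n1)[m Fm]; rewrite Fm; congr (F (nseq n _)).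
  have := f_eq _ _ _ Fm; rewrite size_tuple size_nseq sum_nseq => /(_ erefl).
  by rewrite big_tuple => ->; rewrite mulKf ?gK // pnatr_eq0 -lt0n.
have g_lt : {in range f &, forall u v,
    u < v -> F (nseq n (g u)) < F (nseq n (g v))}.
  move=> _ _ /set_mem[x _ <-] /set_mem[y _ <-] fxy.
  rewrite !gK fltP ?size_nseq //.
  by rewrite !sum_nseq ltr_pM2l // ltr0n.
split=> //; apply: increasing_continuous => //.
(* The image is that of the continuous diagonal, hence an interval. *)
have -> : (fun u => F (nseq n (g u))) @` range f =
    range (fun t => F (nseq n t)).
  apply/seteqP; split=> [_ [_ [x _ <-] <-]|_ [x _ <-]].
    by exists x; rewrite ?gK.
  by exists (f x); [exists x | rewrite gK].
exact/range_is_interval/diag_continuous.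
Qed.

(** * Pre-mean functions are strongly B-preassociative, continuous and increasing *)

(** The mean lies between the values of [f] at a lower and an upper bound of the letters. This gives
    access to the properties of [fn n], which are available on [range f] only. *)
Lemma mean_in_range (R : realType) (I : set R) (f : I -> R) (s : seq I) :
  is_interval I -> continuous f ->
  (forall x y : I, set_val x < set_val y -> f x < f y) -> (0 < size s)%N ->
  range f ((size s)%:R^-1 * \sum_(y <- s) f y).
Proof.
move=> intI cf flt s0; have [lo [hi [los his]]] : exists lo hi : I,
    all (fun y => set_val lo <= set_val y) s /\
    all (fun y => set_val y <= set_val hi) s.
  by case: s s0 => // x s _; exact: seq_bounds.
have fle x y : set_val x <= set_val y -> f x <= f y.
  by rewrite le_eqVlt => /predU1P[/val_inj->//|/flt/ltW].
have sR : 0 < (size s)%:R :> R by rewrite ltr0n.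
have [flo fhi] : range f (f lo) /\ range f (f hi).
  by split; [exists lo | exists hi].
apply: (range_is_interval intI cf flo fhi).
rewrite ler_pdivlMl // ler_pdivrMl //.
elim: s los his {s0 sR} => [|x s IHs] /=; first by rewrite big_nil !mul0r lexx.
case/andP=> lox los /andP[xhi his]; rewrite big_cons -natr1 !mulrDl !mul1r.
have /andP[le1 le2] := IHs los his.
by rewrite (addrC (f x)) !lerD ?fle.
Qed.

(** A matrix neighbourhood is a family of entry neighbourhoods; the one chosen constrains the entry
    [i], [j] alone. *)
Lemma entry_continuous (T : topologicalType) (m n : nat) (i : 'I_m) (j : 'I_n) :
  continuous (fun M : 'M[T]_(m, n) => M i j).
Proof.
move=> M U nU; exists (fun i' j' => [set x | i' = i -> j' = j -> U x]).
  move=> i' j'; have [->|/eqP ni] := eqVneq i' i; last first.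
    by apply: (@nearW _ (nbhs (M i' j'))) => x /= /ni.
  have [->|/eqP nj] := eqVneq j' j; last first.
    by apply: (@nearW _ (nbhs (M i j'))) => x /= _ /nj.
  by apply: filterS nU => x /=.
by move=> N NU; exact: (NU i j).
Qed.

Lemma mean_continuous (R : realType) (T : topologicalType) (n : nat)
    (g : 'I_n -> T -> R) :
  (forall i, continuous (g i)) ->
  continuous (fun t => n%:R^-1 * \sum_(i < n) g i t).
Proof.
move=> cg t; apply: cvgM; first exact: cvg_cst.
apply: cvg_big => [|i _]; first exact: add_continuous.
exact: cg.
Qed.

Lemma spa_of_pre_mean (R : realType) (I : set R) (F : seq I -> R) :
  is_interval I -> quasi_arithmetic_pre_mean F ->
  strongly_B_preassociative F /\
  (forall n, (1 <= n)%N -> continuous_part F n /\ strictly_increasing_part F n).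
Proof.
move=> intI [f [fn [cf flt Hfn FE]]].
have FEs s : (0 < size s)%N ->
    F s = fn (size s) ((size s)%:R^-1 * \sum_(y <- s) f y).
  by move=> s0; rewrite (FE _ (in_tuple s)) // -(big_tuple _ _ _ xpredT).
have in_range n (x : n.-tuple I) : (0 < n)%N ->
    range f (n%:R^-1 * \sum_(i < n) f (tnth x i)).
  move=> n0; rewrite -(big_tuple _ _ _ xpredT) -[X in X%:R^-1](size_tuple x).
  by apply: mean_in_range; rewrite ?size_tuple.
split=> [n x x' K FK Kc|n n1].
  have [n0|n0] := posnP n.
    by clear K FK Kc; subst n; rewrite (tuple0 x) (tuple0 x').
  rewrite !FE //; congr (fn n (_ * _)).
  (* The sums over [K] agree because [fn #|K|] is injective on [range f]; those over the complement
     agree because the restricted strings coincide. *)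
  rewrite (bigID (mem K)) [RHS](bigID (mem K)) /=; congr (_ + _).
    have sumK (z : n.-tuple I) : \sum_(i in K) f (tnth z i) =
        \sum_(y <- restr z K) f y.
      by rewrite big_image.
    have [sz sz'] : size (restr x K) = #|K| /\ size (restr x' K) = #|K|.
      by rewrite !size_image.
    (* The formula for [F] says nothing about the empty string, so an empty [K] is treated apart:
       both sums are then empty. *)
    rewrite !sumK; have [K0|K0] := posnP #|K|.
      by rewrite (size0nil (etrans sz K0)) (size0nil (etrans sz' K0)).
    have := FK; rewrite !FEs ?sz ?sz' //.
    set u := _ * _; set v := _ * _ => fuv.
    have uv : u = v.
      have ru : u \in range f.
        by rewrite inE /u -sz; apply: mean_in_range; rewrite ?sz.
      have rv : v \in range f.
        by rewrite inE /v -sz'; apply: mean_in_range; rewrite ?sz'.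
      have fnlt := (Hfn _ K0).2.
      by case: (ltgtP u v) => // uv;
        [have := fnlt u v ru rv uv | have := fnlt v u rv ru uv];
        rewrite fuv ltxx.
    by move: uv; apply: mulfI; rewrite invr_eq0 pnatr_eq0 -lt0n.
  have sumKc (z : n.-tuple I) :
      \sum_(i | i \notin K) f (tnth z i) = \sum_(y <- restr z (~: K)) f y.
    by rewrite big_image; apply: eq_bigl => i; rewrite inE.
  by rewrite !sumKc Kc.
have [cfn fnlt] := Hfn _ n1; split.
  pose h (v : 'rV[I]_n) := n%:R^-1 * \sum_(i < n) f (v ord0 i).
  pose tup (v : 'rV[I]_n) : n.-tuple I := [tuple v ord0 i | i < n].
  have hE v : h v = n%:R^-1 * \sum_(i < n) f (tnth (tup v) i).
    by congr (_ * _); apply: eq_bigr => i _; rewrite tnth_mktuple.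
  have hr v : range f (h v) by rewrite hE; exact: in_range.
  rewrite /continuous_part.
  have -> : (fun v : 'rV[I]_n => F [seq v ord0 i | i <- enum 'I_n]) = fn n \o h.
    by apply/funext => v /=; rewrite hE -FE.
  have ch : continuous h.
    apply: mean_continuous => i v.
    apply: (@continuous_comp _ _ _ (fun v : 'rV[I]_n => v ord0 i) f).
      exact: entry_continuous.
    exact: cf.
  (* Continuity of [fn n] within [range f] suffices, since [h] takes all its values there. *)
  move=> v; have /subspace_continuousP/(_ _ (hr v)) cfnv := cfn.
  move=> U /cfnv /(ch v); apply: (@filterS _ (nbhs v)) => w /=.
  by apply; exact: hr.
move=> x y k xy xyk; rewrite !FE //; apply: fnlt; rewrite ?inE;
  try exact: in_range.
rewrite ltr_pM2l ?invr_gt0 ?ltr0n // (bigD1 k) //= [ltRHS](bigD1 k) //=.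
rewrite (eq_bigr (fun i => f (tnth y i))); last by move=> i /xy->.
by rewrite ltrD2r flt.
Qed.

Theorem theorem3p6 (R : realType) (I : set R) (F : seq I -> R) :
  nontrivial_interval I ->
  (strongly_B_preassociative F /\
   (forall n : nat, (1 <= n)%N ->
      continuous_part F n /\ strictly_increasing_part F n))
  <-> quasi_arithmetic_pre_mean F.
Proof.
move=> ntI; split; first by case; exact: pre_mean_of_spa.
by case: ntI => intI _ _; exact: spa_of_pre_mean.
Qed.
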